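(* Let $R$ be a unital $*$-ring, let $e\in R$ be an invertible element with $e^*=e$, and let $a,b\in R$ be $e$-weighted core invertible. If $ab=b^2$, then: (i) $ab$ is $e$-weighted core invertible and $(ab)^{e,(\#)}=a^{e,(\#)}b^{e,(\#)}$; (ii) $a a^{e,(\#)}b^{e,(\#)}\,(b a a^{e,(\#)})^2=b a a^{e,(\#)}$, $\;e b a a^{e,(\#)}\,(a a^{e,(\#)}b^{e,(\#)})^2=e b^{e,(\#)}$, and $(e b a a^{e,(\#)}b^{e,(\#)})^*=e b a a^{e,(\#)}b^{e,(\#)}$.
   Context: A unital $*$-ring is an associative ring $R$ with unity $1$ equipped with an involution $*:R\to R$ satisfying $(a+b)^*=a^*+b^*$, $(ab)^*=b^*a^*$ and $(a^* )^*=a$ for all $a,b\in R$. For an invertible element $e\in R$ with $e^*=e$, an element $a\in R$ is $e$-weighted core invertible if there exists $x\in R$ with $ax^2=x$, $xa^2=a$ and $(eax)^*=eax$; such an $x$ is unique when it exists, is called the $e$-weighted core inverse of $a$, and is denoted $a^{e,(\#)}$. *)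

(* Defs.v *)
From HB Require Import structures.
From mathcomp Require Import all_boot all_algebra.
From mathcomp Require Import boolp classical_sets.

Set Implicit Arguments.
Unset Strict Implicit.
Unset Printing Implicit Defensive.

Import GRing.Theory.
Local Open Scope ring_scope.

(* The base is pzRingType, so that the zero ring is not excluded. *)
HB.mixin Record PzRing_isStarRing R of GRing.PzRing R := {
  star : R -> R;
  starD : forall a b : R, star (a + b) = star a + star b;
  starM : forall a b : R, star (a * b) = star b * star a;
  starK : forall a : R, star (star a) = a
}.

#[short(type="starRingType")]
HB.structure Definition StarRing :=
  {R of GRing.PzRing R & PzRing_isStarRing R}.

(* GRing.unit is only available on a unitRingType, which is nontrivial. *)
Definition invertible (R : pzRingType) (e : R) : Prop :=
  exists f : R, e * f = 1 /\ f * e = 1.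

Definition is_wcore_inverse (R : starRingType) (e a x : R) : Prop :=
  [/\ a * x ^+ 2 = x, x * a ^+ 2 = a & star (e * a * x) = e * a * x].

Definition wcore_invertible (R : starRingType) (e a : R) : Prop :=
  exists x : R, is_wcore_inverse e a x.

(* Junk value 0 when a is not e-weighted core invertible; otherwise the
   inverse is unique by is_wcore_inverse_unique below. *)
Definition wcore_inverse (R : starRingType) (e a : R) : R :=
  xget 0 [set x : R | is_wcore_inverse e a x]%classic.

Lemma is_wcore_inverse_unique (R : starRingType) (e a x y : R) :
  invertible e -> star e = e ->
  is_wcore_inverse e a x -> is_wcore_inverse e a y -> x = y.
Proof.
move=> [f [_ fe]] se [ax xa sx] [ay ya sy].
have proj u v : a * u ^+ 2 = u -> v * a ^+ 2 = a -> v * (a * u) = u.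
  by move=> au va; rewrite -{1}au !mulrA -(mulrA v) -expr2 va -mulrA.
have absorb u v : v * a ^+ 2 = a -> a * v ^+ 2 = v -> a * v * (a * u) = a * u.
  move=> va av; have ava : a * v * a = a.
    by rewrite -{2}va expr2 !mulrA -(mulrA a v v) -expr2 av -mulrA -expr2 va.
  by rewrite mulrA ava.
have sxe : star (a * x) * e = e * (a * x).
  by rewrite -{1}se -starM !mulrA.
have sye : star (a * y) * e = e * (a * y).
  by rewrite -{1}se -starM !mulrA.
have axy : a * x = a * y.
  have E : e * (a * x) = e * (a * y).
    rewrite -(absorb x y ya ay) mulrA -sye -mulrA -sxe mulrA -starM.
    by rewrite (absorb y x xa ax).
  by rewrite -[a * x]mul1r -fe -mulrA E mulrA fe mul1r.
by rewrite -[LHS](proj x x ax xa) axy (proj y x ay xa).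
Qed.

Lemma wcore_inverseP (R : starRingType) (e a : R) :
  wcore_invertible e a -> is_wcore_inverse e a (wcore_inverse e a).
Proof. by move=> [x hx]; rewrite /wcore_inverse; case: xgetP => [y _ //|/(_ x)]. Qed.

Lemma wcore_inverse_eq (R : starRingType) (e a x : R) :
  invertible e -> star e = e ->
  is_wcore_inverse e a x -> wcore_inverse e a = x.
Proof.
move=> ie se hx; apply: (is_wcore_inverse_unique ie se _ hx).
by apply: wcore_inverseP; exists x.
Qed.

(* Main.v *)
Require Import Defs.
From mathcomp Require Import all_boot all_algebra.

Set Implicit Arguments.
Unset Strict Implicit.
Unset Printing Implicit Defensive.

Import GRing.Theory.
Local Open Scope ring_scope.

(** Write [x] and [y] for the weighted core inverses of [a] and [b].  The
    hypothesis [a * b = b ^+ 2] says that [a] and [b] act alike on the right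
    ideal [b R], which contains [y = b * y ^+ 2]; hence [a * y = b * y], and
    [y = b * y ^+ 2 = a * y ^+ 2] lies in [a R] too.

    On [a R] the elements [a * x] and [x * a] both act as the identity,
    since [a * x * a = a] and [x * a ^+ 2 = a].
    Applied to [y] and [b], this gives [a * x * y = y] and [a * x * b = b]
    ([wcore_proj_rinv], [wcore_proj_base]), and it also gives
    [x * y = x * a * y ^+ 2 = y ^+ 2] ([wcore_inv_mul_rinv]).  So [x * y] is
    just [y ^+ 2], which is the weighted core inverse of [b ^+ 2 = a * b]: the
    symmetry condition only involves [b ^+ 2 * y ^+ 2 = b * y]
    ([is_wcore_inverse_sqr]).  In the same way the identities of the second part
    reduce to the defining ones for [y], once [a * x] has been absorbed. *)

Section CoreInverse.

Variables (R : starRingType) (e : R).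
Implicit Types a b x y : R.

Lemma wcore_mulK a x : is_wcore_inverse e a x -> a * x * a = a.
Proof.
case=> ax xa _.
(* Expanding the right factor [a] as [x * a ^+ 2] brings out [a * x ^+ 2]. *)
by rewrite -{2}xa mulrA -(mulrA a x x) -[x * x]expr2 ax xa.
Qed.

Lemma wcore_mul_sqr a x : is_wcore_inverse e a x -> a ^+ 2 * x ^+ 2 = a * x.
Proof. by case=> ax _ _; rewrite [a ^+ 2]expr2 -mulrA ax. Qed.

(** The projection [b ^+ 2 * y ^+ 2] is [b * y] again, so it is still
    [e]-symmetric and still fixes [y]; and [y ^+ 2 * b ^+ 4] collapses from the
    inside by using [y * b ^+ 2 = b] twice. *)
Lemma is_wcore_inverse_sqr b y :
  is_wcore_inverse e b y -> is_wcore_inverse e (b ^+ 2) (y ^+ 2).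
Proof.
move=> hy; have bbyy := wcore_mul_sqr hy; case: hy => byy ybb sby; split.
- by rewrite [(y ^+ 2) ^+ 2]expr2 mulrA bbyy expr2 mulrA -(mulrA b) -expr2 byy.
- rewrite [(b ^+ 2) ^+ 2]expr2 [y ^+ 2]expr2 mulrA -(mulrA y y) ybb.
  by rewrite {2}[b ^+ 2]expr2 mulrA -(mulrA y b b) -expr2 ybb.
- by rewrite -mulrA bbyy mulrA.
Qed.

Section SquareProduct.

Variables (a b x y : R).
Hypotheses (hx : is_wcore_inverse e a x) (hy : is_wcore_inverse e b y).
Hypothesis (hab : a * b = b ^+ 2).

(** [y] lies in [b R], where [a] and [b] act alike. *)
Lemma wcore_mul_rinv : a * y = b * y.
Proof.
by rewrite -(wcore_mul_sqr hy) -hab -mulrA; case: hy => -> _ _.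
Qed.

Lemma wcore_rinv_sqr : a * y ^+ 2 = y.
Proof.
by rewrite expr2 mulrA wcore_mul_rinv -mulrA -expr2; case: hy.
Qed.

(** [a * x] fixes [y] because [y = a * y ^+ 2] lies in [a R]. *)
Lemma wcore_proj_rinv : a * x * y = y.
Proof. by rewrite -{1}wcore_rinv_sqr mulrA (wcore_mulK hx) wcore_rinv_sqr. Qed.

(** [b = b * y * b = a * y * b] lies in [a R] as well. *)
Lemma wcore_proj_base : a * x * b = b.
Proof.
by rewrite -{1}(wcore_mulK hy) -wcore_mul_rinv !mulrA (wcore_mulK hx)
  wcore_mul_rinv (wcore_mulK hy).
Qed.

(** [x * a] is the identity on [a R], and [y] equals [a * y ^+ 2], where
    [y ^+ 2] itself belongs to [a R]. *)
Lemma wcore_inv_mul_rinv : x * y = y ^+ 2.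
Proof.
have xay : x * a * y = y.
  rewrite -{1}wcore_rinv_sqr mulrA -(mulrA x a a) -expr2.
  by case: hx => _ -> _; rewrite wcore_rinv_sqr.
by rewrite -{1}wcore_rinv_sqr [y ^+ 2]expr2 !mulrA xay.
Qed.

End SquareProduct.

End CoreInverse.

Theorem theorem3p8 (R : starRingType) (e a b : R)
    (e_inv : invertible e) (e_sym : star e = e)
    (a_wc : wcore_invertible e a) (b_wc : wcore_invertible e b)
    (hab : a * b = b ^+ 2) :
  (wcore_invertible e (a * b) /\
   wcore_inverse e (a * b) = wcore_inverse e a * wcore_inverse e b) /\
  [/\ a * wcore_inverse e a * wcore_inverse e b
        * (b * a * wcore_inverse e a) ^+ 2 = b * a * wcore_inverse e a,
      e * b * a * wcore_inverse e a
        * (a * wcore_inverse e a * wcore_inverse e b) ^+ 2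
        = e * wcore_inverse e b
    & star (e * b * a * wcore_inverse e a * wcore_inverse e b)
        = e * b * a * wcore_inverse e a * wcore_inverse e b].
Proof.
have hx := wcore_inverseP a_wc; have hy := wcore_inverseP b_wc.
move: (wcore_inverse e a) (wcore_inverse e b) hx hy => x y hx hy.
have axy := wcore_proj_rinv hx hy hab.
have axb := wcore_proj_base hx hy hab.
have hz : is_wcore_inverse e (a * b) (x * y).
  by rewrite hab (wcore_inv_mul_rinv hx hy hab); exact: is_wcore_inverse_sqr.
have [byy ybb sby] := hy.
split; first by split; [exists (x * y) | exact: wcore_inverse_eq].
have ebaxy : e * b * a * x * y = e * b * y.
  by rewrite -2!mulrA (mulrA a) axy.
split.
- (* Absorbing [a * x] into [b] turns the left-hand side into
     [y * b ^+ 2 * a * x]. *)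
  rewrite axy [X in y * X]expr2 !mulrA.
  rewrite -(mulrA (y * b) a x) -(mulrA (y * b) _ b) axb.
  by rewrite -(mulrA y b b) -expr2 ybb.
- by rewrite axy expr2 mulrA ebaxy -2!mulrA -expr2 byy.
- by rewrite ebaxy.
Qed.
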